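(* For all $C\ge 0$ there exists $D\ge 0$ with the following property. Let $X$ be a geodesic metric space and let $A\subseteq X$ be a $C$-strongly contracting subset satisfying Gromov's 4-point condition with constant $C$. Then $e(A)$ is $D$-strongly contracting in the injective hull $E(X)$.
   Context: For a metric space $(X,d)$ let $\Delta=\{f\in\mathbb{R}^X : f(x)+f(y)\ge d(x,y)\ \forall x,y\in X\}$, partially ordered by $f\le g$ iff $f(x)\le g(x)$ for all $x\in X$. The injective hull $E(X)$ is the set of minimal elements of $\Delta$, with the metric $d_\infty(f,g)=\sup_{x\in X}|f(x)-g(x)|$. The map $e:X\to E(X)$, $x\mapsto d(x,\cdot)$, is an isometric embedding. For a subset $Y$ of a metric space $Z$ and $x\in Z$, let $\pi_Y(x)=\{y\in Y: d(x,y)\le d(x,Y)+1\}$, and for $B\subseteq Z$ let $\pi_Y(B)=\bigcup_{x\in B}\pi_Y(x)$. $Y$ is $D$-strongly contracting in $Z$ if $\mathrm{diam}(\pi_Y(B))\le D$ for every closed ball $B$ of $Z$ disjoint from $Y$. A metric space $A$ (here a subset with the restricted metric) satisfies Gromov's 4-point condition with constant $\delta$ if $d(x,y)+d(w,z)\le\max\{d(x,z)+d(w,y),\,d(x,w)+d(y,z)\}+\delta$ for all $x,y,w,z\in A$. *)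

(* Defs.v *)
From HB Require Import structures.
From mathcomp Require Import all_boot all_order all_algebra.
From mathcomp Require Import all_classical all_reals all_analysis.
From mathcomp Require Import lra.

Set Implicit Arguments.
Unset Strict Implicit.
Unset Printing Implicit Defensive.

Import Order.TTheory GRing.Theory Num.Theory.

Local Open Scope classical_set_scope.
Local Open Scope ring_scope.

Section MetricNotions.
Context {R : realType} {Z : metricType R}.
Implicit Types (x : Z) (Y B : set Z).

Definition geodesic_space : Prop :=
  forall x y : Z, exists gamma : R -> Z,
    [/\ gamma 0 = x, gamma (mdist x y) = y &
        {in `[0, mdist x y] &, forall s t,
           mdist (gamma s) (gamma t) = `|s - t|}].

(* The library's [closed_ball] is the closure of the open ball, which in a
   general metric space may be strictly smaller. *)
Definition mclosed_ball x (r : R) : set Z := [set y | mdist x y <= r].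

(* [inf set0 = 0], but the distance to [set0] is never used: see [proj]. *)
Definition dist_to_set x Y : R := inf [set mdist x y | y in Y].

Definition proj Y x : set Z :=
  [set y | Y y /\ mdist x y <= dist_to_set x Y + 1].

Definition proj_set Y B : set Z := \bigcup_(x in B) proj Y x.

(* [+oo] if [B] is unbounded, and [-oo] (rather than 0) if [B] is empty. *)
Definition diam B : \bar R :=
  ereal_sup [set (mdist p.1 p.2)%:E | p in B `*` B].

Definition strongly_contracting (D : R) Y : Prop :=
  forall x (r : R), 0 <= r -> mclosed_ball x r `&` Y = set0 ->
    (diam (proj_set Y (mclosed_ball x r)) <= D%:E)%E.

Definition four_point (delta : R) Y : Prop :=
  forall x y w z, Y x -> Y y -> Y w -> Y z ->
    mdist x y + mdist w z <=
      Num.max (mdist x z + mdist w y) (mdist x w + mdist y z) + delta.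

End MetricNotions.

Arguments geodesic_space {R} Z.

Section InjectiveHull.
Context {R : realType} {X : metricType R}.

Definition Delta : set (X -> R) :=
  [set f | forall x y, mdist x y <= f x + f y].

Definition minimal_in_Delta (f : X -> R) : Prop :=
  Delta f /\ forall g, Delta g -> (forall x, g x <= f x) -> g = f.

End InjectiveHull.

Record injective_hull {R : realType} (X : metricType R) := InjectiveHull {
  hull_fun :> X -> R;
  hull_funP : minimal_in_Delta hull_fun }.

HB.instance Definition _ (R : realType) (X : metricType R) :=
  gen_eqMixin (injective_hull X).
HB.instance Definition _ (R : realType) (X : metricType R) :=
  gen_choiceMixin (injective_hull X).

Section HullMetric.
Context {R : realType} {X : metricType R}.
Implicit Types f g h : injective_hull X.

Definition hull_dist f g : R := sup [set `|f x - g x| | x in [set: X]].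

Lemma hull_ext f g : f =1 g -> f = g.
Proof.
case: f g => [f Pf] [g Pg] /= fg; have {}fg : f = g by exact/funext.
by case: _ / fg Pg => Pg; congr InjectiveHull; exact: Prop_irrelevance.
Qed.

Lemma hull_ge0 f x : 0 <= f x.
Proof. by have [/(_ x x)] := hull_funP f; rewrite mdistxx; lra. Qed.

Lemma hull_lipschitz f x y : f x <= mdist x y + f y.
Proof.
have [fD fmin] := hull_funP f.
pose g z := if z == x then Num.min (f x) (mdist x y + f y) else f z.
have gx : g x = Num.min (f x) (mdist x y + f y) by rewrite /g eqxx.
have gx0 : 0 <= g x.
  by rewrite gx le_min hull_ge0 addr_ge0 ?hull_ge0 ?mdist_ge0.
have gxz z : z != x -> mdist x z <= g x + g z.
  move=> zx; have -> : g z = f z by rewrite /g (negbTE zx).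
  rewrite gx -lerBlDr le_min lerBlDr fD /=.
  have := metric_triangle x y z; have := fD y z; lra.
have gD : Delta g.
  move=> a b; have [->|ax] := eqVneq a x; have [->|bx] := eqVneq b x.
  - by rewrite mdistxx addr_ge0.
  - exact: gxz.
  - by rewrite metric_sym addrC; exact: gxz.
  - by rewrite /g (negbTE ax) (negbTE bx); exact: fD.
have gf z : g z <= f z.
  by rewrite /g; case: eqVneq => [->|//]; rewrite ge_min lexx.
by rewrite -{1}(fmin _ gD gf) gx ge_min lexx orbT.
Qed.

Lemma hull_dist_bound f g y x : `|f x - g x| <= f y + g y.
Proof.
have [fD _] := hull_funP f; have [gD _] := hull_funP g.
have := hull_lipschitz f x y; have := hull_lipschitz g x y.
by have := fD x y; have := gD x y; rewrite ler_norml; lra.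
Qed.

Lemma hull_dist_ub f g x : `|f x - g x| <= hull_dist f g.
Proof.
apply: ub_le_sup; last by exists x.
by exists (f x + g x) => _ [z _ <-]; exact: hull_dist_bound.
Qed.

Lemma hull_dist_le f g (r : R) :
  0 <= r -> (forall x, `|f x - g x| <= r) -> hull_dist f g <= r.
Proof.
move=> r0 fgr; rewrite /hull_dist; set S := [set _ | _ in _].
have [->|/set0P S0] := eqVneq S set0; first by rewrite sup0.
by apply: ge_sup => // _ [z _ <-].
Qed.

Lemma hull_dist_ge0 f g : 0 <= hull_dist f g.
Proof.
rewrite /hull_dist; have [|/set0P[_ [x _ _]]] :=
  eqVneq [set `|f x - g x| | x in [set: X]] set0; first by move->; rewrite sup0.
exact: le_trans (normr_ge0 _) (hull_dist_ub f g x).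
Qed.

Lemma hull_distxx f : hull_dist f f = 0.
Proof.
apply/le_anti; rewrite hull_dist_ge0 andbT; apply: hull_dist_le => // x.
by rewrite subrr normr0.
Qed.

Lemma hull_dist_positivity f g : hull_dist f g = 0 -> f = g.
Proof.
move=> fg0; apply: hull_ext => x; apply/eqP; rewrite -subr_eq0 -normr_le0.
by rewrite -fg0; exact: hull_dist_ub.
Qed.

Lemma hull_dist_sym f g : hull_dist f g = hull_dist g f.
Proof. by rewrite /hull_dist; under eq_imagel do rewrite distrC. Qed.

Lemma hull_dist_triangle g f h :
  hull_dist f h <= hull_dist f g + hull_dist g h.
Proof.
apply: hull_dist_le => [|x]; first by rewrite addr_ge0 ?hull_dist_ge0.
by rewrite (le_trans (ler_distD (g x) _ _))// lerD ?hull_dist_ub.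
Qed.

HB.instance Definition _ := @isMetric.Build R (injective_hull X)
  hull_dist hull_distxx hull_dist_positivity hull_dist_sym hull_dist_triangle.

Lemma mdist_minimal (x : X) : minimal_in_Delta (fun y => mdist x y).
Proof.
split=> [y z|g gD gx]; first by rewrite (metric_sym x y) metric_triangle.
apply/funext => y; apply/le_anti; rewrite gx /=.
by have := gD x y; have := gx x; rewrite mdistxx; lra.
Qed.

Definition hull_embed (x : X) : injective_hull X :=
  InjectiveHull (mdist_minimal x).

Lemma hull_embed_isometry x y :
  mdist (hull_embed x) (hull_embed y) = mdist x y.
Proof.
apply/le_anti/andP; split.
  apply: hull_dist_le => [|z /=]; first exact: mdist_ge0.
  have := metric_triangle x y z; have := metric_triangle y x z.
  by rewrite (metric_sym y x) ler_norml; lra.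
have := hull_dist_ub (hull_embed x) (hull_embed y) y.
by rewrite /= mdistxx subr0 ger0_norm ?mdist_ge0.
Qed.

End HullMetric.

(* Main.v *)
Require Import Defs.
From mathcomp Require Import all_boot all_order all_algebra.
From mathcomp Require Import all_classical all_reals all_analysis.
From mathcomp Require Import lra.

(** The distance in the hull from [f] to [hull_embed a] is the number [f a]
([mdist_hull_embed]), so everything about the projection of [f] to the image
of [A] can be read off the restriction of [f] to [A].  The other values of [f]
enter through tightness: minimality gives, for each [x], a point [y] with
[f x + f y] equal to [mdist x y] up to an error as small as desired.

Strong contraction in [X] makes projection points coarse gates
([proj_gate]): a path from [x] to a point of [A] might as well go through
the projection of [x]; and a path between two points whose projections are
far apart might as well go through both projections ([proj_two_gates]).
Together with the four-point condition, this makes [A] look like a quasiconvex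
coarse tree from which the rest of [X] hangs.  If [y] is a tight partner of [a],
then [f a] is roughly [mdist a y - f y], which is the distance from [a] to the
projection of [y] plus a number depending on [y] only: on [A], a hull function
is coarsely a supremum of distance functions shifted by constants.  On a segment
of a tree such a supremum is monotone or V-shaped, always with slopes plus or
minus one ([hull_coarsely_convex]), so [f] grows with slope one away from its
minimum on [A] ([hull_growth]).

Let now [f] be the centre of a ball of radius [r] disjoint from the image of
[A], [g] a point of that ball, and [p] and [q] almost minimisers on [A] of [f]
and [g].  Slope-one growth forces a tight partner [y] of [q] for [f] to project
to a point [b] beyond [p], and a tight partner [z] of [p] for [g] to project to
a point [c] beyond [q].  If [p] and [q] are far apart, then [b], [p], [q], [c]
lie in this order along a coarse segment, the path from [y] to [z] follows that
segment, and [f z - g z] is roughly [f p + mdist p q + g q].  This is at most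
the distance from [f] to [g], hence at most [r], hence less than [f p], which
bounds [mdist p q] ([hull_near_projections]).  Almost minimisers
of two functions in the ball are then compared through the same [p]. *)

Import Order.TTheory GRing.Theory Num.Theory.

Local Open Scope classical_set_scope.
Local Open Scope ring_scope.

(** * Projections and diameters in a metric space *)

Section Projections.
Context {R : realType} {Z : metricType R}.
Implicit Types (x y z a b c : Z) (A Y B : set Z).

Lemma dist_to_set_le x {a A} : A a -> dist_to_set x A <= mdist x a.
Proof.
move=> Aa; apply: ge_inf; last by exists a.
by exists 0 => _ [y _ <-]; exact: mdist_ge0.
Qed.

Lemma proj_nonempty x A : A !=set0 -> exists b, Defs.proj A x b.
Proof.
move=> [a Aa]; set S := [set mdist x y | y in A].
have hS : has_inf S.
  split; first by exists (mdist x a), a.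
  by exists 0 => _ [y _ <-]; exact: mdist_ge0.
have [_ [b Ab <-] lt_b] := inf_adherent (@ltr01 R) hS.
by exists b; split => //; exact: ltW.
Qed.

Lemma proj_le {A x b} a : Defs.proj A x b -> A a -> mdist x b <= mdist x a + 1.
Proof. by move=> [_ xb] /(dist_to_set_le x) xa; lra. Qed.

Lemma le_diam {D : R} {B x y} :
  (diam B <= D%:E)%E -> B x -> B y -> mdist x y <= D.
Proof.
move=> BD Bx By; rewrite -lee_fin; apply: le_trans BD.
by apply: ereal_sup_ubound; exists (x, y).
Qed.

Lemma diam_le (D : R) B :
  (forall x y, B x -> B y -> mdist x y <= D) -> (diam B <= D%:E)%E.
Proof.
move=> BD; apply: ge_ereal_sup => _ [[x y] [/= Bx By] <-].
by rewrite lee_fin; exact: BD.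
Qed.

(** Strong contraction in pointwise form, with disjointness from [A] expressed
by distances to the centre. *)
Lemma strongly_contractingP (C : R) A x (r : R) y z b c :
  strongly_contracting C A -> 0 <= r -> (forall a, A a -> r < mdist x a) ->
  mdist x y <= r -> mdist x z <= r -> Defs.proj A y b -> Defs.proj A z c ->
  mdist b c <= C.
Proof.
move=> cA r0 rA xy xz yb zc.
apply: (le_diam (cA x r r0 _)); [|by exists y|by exists z].
by apply/seteqP; split => // a [/= xa /rA]; rewrite ltNge xa.
Qed.

End Projections.

(** * Strongly contracting subsets of geodesic spaces *)

Section Gates.
Context {R : realType} {X : metricType R} {C : R} {A : set X}.
Context (hC : 0 <= C) (geoX : geodesic_space X).
Context (cA : strongly_contracting C A).
Implicit Types x y z a b c : X.

Lemma geodesic_point x y (s : R) : 0 <= s <= mdist x y ->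
  exists w, mdist x w = s /\ mdist w y = mdist x y - s.
Proof.
move=> /andP[s0 sL]; have [g [g0 gL giso]] := geoX x y.
have i0 : 0 \in `[0, mdist x y] by rewrite in_itv /= lexx mdist_ge0.
have iL : mdist x y \in `[0, mdist x y] by rewrite in_itv /= lexx mdist_ge0.
have is_ : s \in `[0, mdist x y] by rewrite in_itv /= s0.
exists (g s); split.
  by rewrite -{1}g0 giso// sub0r normrN ger0_norm.
by rewrite -{1}gL giso// distrC ger0_norm// subr_ge0.
Qed.

(** Follow a geodesic from [x] to [a] by one step of length almost
[dist_to_set x A], to [w].  The step stays in a ball missing [A], so the
projection moves by at most [C], whereas the detour through the projection
gets shorter by about [mdist w c].  As long as [w] is further than [C + 2] from
its projection, the excess [mdist x b + mdist b a - mdist x a] thus does not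
decrease from [x] to [w]; close to [A] the excess is bounded by the triangle
inequality.  Each step shortens the geodesic by more than [1], whence the
induction on an integer bound for its length. *)
Lemma proj_gate x a b :
  A a -> Defs.proj A x b -> mdist x b + mdist b a <= mdist x a + (2 * C + 6).
Proof.
have C0 := hC.
move=> Aa.
have [n] : exists n, mdist x a <= n%:R.
  by exists (Num.truncn (mdist x a)).+1; rewrite ltW// truncnS_gt.
elim: n => [|n IH] in x b * => xan xb; have [Ab xbR] := xb;
  have xaR := dist_to_set_le x Aa;
  have tri := metric_triangle b x a; rewrite (metric_sym b x) in tri.
  by lra.
(* Beyond distance [2] the step length [r] is more than [1]. *)
have [R2|R2] := leP (dist_to_set x A) 2; first by lra.
set r := dist_to_set x A - 1.
have [|w [xw wa]] := geodesic_point x a r; first by rewrite /r; lra.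
have [c wc] := proj_nonempty w A (ex_intro _ a Aa).
have bc : mdist b c <= C.
  apply: (strongly_contractingP C A x r x w) => //.
  - by rewrite /r; lra.
  - by move=> a' /(dist_to_set_le x); rewrite /r; lra.
  - by rewrite mdistxx /r; lra.
  - by rewrite xw.
have wan : mdist w a <= n%:R by move: xan; rewrite wa /r -natr1; lra.
have := IH w c wan wc; have := metric_triangle b c a.
have := metric_triangle c w a; rewrite (metric_sym c w) /r in wa *.
by have [] := leP (C + 2) (mdist w c); lra.
Qed.

(** Add the two gate inequalities for the pairs [(y, c)] and [(z, b)]. *)
Lemma proj_lipschitz y z b c : Defs.proj A y b -> Defs.proj A z c ->
  mdist b c <= mdist y z + (2 * C + 6).
Proof.
have C0 := hC.
move=> yb zc; have := proj_gate y c b zc.1 yb; have := proj_gate z b c yb.1 zc.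
have := metric_triangle y z c; have := metric_triangle z y b.
by rewrite (metric_sym z y) (metric_sym c b); lra.
Qed.

(** A uniform version of strong contraction for balls centred at [y]: when [y]
is within [1] of [A] the radius is [0], and the bound comes from the size of a
single projection. *)
Lemma ball_shadow y b w c : Defs.proj A y b -> Defs.proj A w c ->
  mdist y w <= Num.max 0 (dist_to_set y A - 1) -> mdist b c <= C + 4.
Proof.
have C0 := hC.
move=> yb wc; have [R1|R1] := leP (dist_to_set y A - 1) 0 => yw.
  have wE : y = w.
    by apply: mdist_positivity; apply/le_anti; rewrite yw mdist_ge0.
  have := yb.2; have := wc.2; rewrite -wE.
  by have := metric_triangle b y c; rewrite (metric_sym b y); lra.
suff : mdist b c <= C by lra.
apply: (strongly_contractingP C A y (dist_to_set y A - 1) y w) => //.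
- exact: ltW.
- by move=> a /(dist_to_set_le y); lra.
- by rewrite mdistxx; lra.
Qed.

(** The balls around [y] and [z] of radius almost the distance to [A] project
to sets of diameter about [C].  If the two balls meet on a geodesic from [y] to
[z], the projections are at most [2 * C + 8] apart.  Otherwise the geodesic has
a middle piece between the balls, whose length is at least [mdist b c] up to a
constant since projection is coarsely Lipschitz. *)
Lemma proj_two_gates y z b c :
  Defs.proj A y b -> Defs.proj A z c -> 2 * C + 8 < mdist b c ->
  mdist y b + mdist b c + mdist c z <= mdist y z + (4 * C + 18).
Proof.
have C0 := hC.
move=> yb zc bc; rewrite (metric_sym c z).
have [Ab _] := yb; have [Ac _] := zc.
have A0 : A !=set0 by exists b.
set r := Num.max 0 (dist_to_set y A - 1).
set s := Num.max 0 (dist_to_set z A - 1).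
have r0 : 0 <= r by rewrite le_max lexx.
have s0 : 0 <= s by rewrite le_max lexx.
have rR : dist_to_set y A - 1 <= r by rewrite le_max lexx orbT.
have sR : dist_to_set z A - 1 <= s by rewrite le_max lexx orbT.
have [zr|zr] := leP (mdist y z) (r + s).
  have [w [yw zw]] : exists w, mdist y w <= r /\ mdist z w <= s.
    have [yzr|yzr] := leP (mdist y z) r.
      by exists z; rewrite mdistxx.
    have [|w [yw wz]] := geodesic_point y z r; first by rewrite r0 ltW.
    by exists w; rewrite yw metric_sym wz; split=> //; lra.
  have [e we] := proj_nonempty w A A0.
  have := ball_shadow y b w e yb we yw; have := ball_shadow z c w e zc we zw.
  by have := metric_triangle b e c; rewrite (metric_sym e c); lra.
have [|w [yw wz]] := geodesic_point y z r; first by rewrite r0; lra.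
have [|w' [zw' w'w]] := geodesic_point z w s.
  by rewrite (metric_sym z w) wz s0; lra.
have [e we] := proj_nonempty w A A0.
have [e' we'] := proj_nonempty w' A A0.
have := proj_lipschitz w w' e e' we we'.
have := ball_shadow y b w e yb we; rewrite -/r yw => /(_ (lexx _)).
have := ball_shadow z c w' e' zc we'; rewrite -/s zw' => /(_ (lexx _)).
have := metric_triangle b e c; have := metric_triangle e e' c.
move: w'w; rewrite (metric_sym w' w) (metric_sym z w) wz (metric_sym e' c).
by have := yb.2; have := zc.2; lra.
Qed.

(** Both endpoints being gated by the projection [a] of a point [w] of the
geodesic, adding the two inequalities leaves [2 * mdist w a] below a
constant. *)
Lemma quasiconvex p q (s : R) : A p -> A q -> 0 <= s <= mdist p q ->
  exists a, [/\ A a, mdist a p <= s + (2 * C + 6) &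
                mdist a q <= mdist p q - s + (2 * C + 6)].
Proof.
have C0 := hC.
move=> Ap Aq /(geodesic_point p q)[w [pw wq]].
have [a wa] := proj_nonempty w A (ex_intro _ p Ap).
have := proj_gate w p a Ap wa; have := proj_gate w q a Aq wa.
rewrite (metric_sym w p) pw wq => qa pa; exists a.
by split; [exact: wa.1| |]; have := mdist_ge0 w a; lra.
Qed.

End Gates.

(** * Functions in the injective hull *)

Section HullFunctions.
Context {R : realType} {X : metricType R}.
Implicit Types (f g : injective_hull X) (x y a : X).

Lemma hull_ge_mdist f x y : mdist x y <= f x + f y.
Proof. by have [+ _] := hull_funP f; exact. Qed.

Lemma mdist_hull_embed f a : mdist f (hull_embed a) = f a.
Proof.
apply/le_anti/andP; split.
  apply: hull_dist_le => [|x /=]; first exact: hull_ge0.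
  have := hull_lipschitz f x a; have := hull_ge_mdist f a x.
  by rewrite (metric_sym x a) ler_norml; lra.
have := hull_dist_ub f (hull_embed a) a.
by rewrite /= mdistxx subr0 ger0_norm ?hull_ge0.
Qed.

(** Otherwise the value at [x] could be lowered by [eps / 2]; that the
inequality also fails at [y = x] keeps the lowered value nonnegative. *)
Lemma hull_tight f x (eps : R) : 0 < eps ->
  exists y, f x + f y <= mdist x y + eps.
Proof.
move=> e0; apply: contrapT => /forallNP tight.
have {tight} loose y : mdist x y + eps < f x + f y.
  by rewrite ltNge; apply/negP; exact: tight.
have [fD fmin] := hull_funP f.
pose g z := if z == x then f x - eps / 2 else f z.
have gD : Delta g.
  move=> y z; rewrite /g; have [->|_] := eqVneq y x; have [->|_] := eqVneq z x.
  - by have := loose x; rewrite mdistxx; lra.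
  - by have := loose z; lra.
  - by have := loose y; rewrite (metric_sym y x); lra.
  - exact: fD.
have gf z : g z <= f z by rewrite /g; case: eqVneq => [->|//]; lra.
by have := congr1 (@^~ x) (fmin g gD gf); rewrite /g eqxx; lra.
Qed.

Lemma proj_hull_embed A f g :
  Defs.proj (hull_embed @` A) f g ->
  exists2 p, hull_embed p = g & A p /\ forall a, A a -> f p <= f a + 1.
Proof.
move=> fg; have [[p Ap pg] _] := fg; exists p => //; split => // a Aa.
rewrite -!mdist_hull_embed pg; apply: proj_le fg _; by exists a.
Qed.

End HullFunctions.

(** * Hull functions on a hyperbolic strongly contracting subset *)

Section HullOverHyperbolic.
Context {R : realType} {X : metricType R} {C : R} {A : set X}.
Context (hC : 0 <= C) (geoX : geodesic_space X).
Context (cA : strongly_contracting C A) (hypA : four_point C A).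
Implicit Types (f g : injective_hull X) (p q a b c y z : X).

Let gate := @proj_gate R X C A hC geoX cA.

(** For a point [a] of [A] near the point at distance [s] from [p] on a
geodesic to [q], take a tight partner [y] of [a] with projection [b].  The
four-point condition on [a], [b], [p], [q] says that [b] is seen from [a] in
the direction away from [p] or away from [q], so that [f] rises at full slope
from [a] to that endpoint. *)
Lemma hull_coarsely_convex f p q (s : R) : A p -> A q ->
  0 <= s <= mdist p q ->
  exists2 a, A a &
    f a <= Num.max (f p - s) (f q - (mdist p q - s)) + (5 * C + 13).
Proof.
have C0 := hC.
move=> Ap Aq spq; have [a [Aa ap aq]] := quasiconvex hC geoX cA p q s Ap Aq spq.
exists a => //; have [y ay] := hull_tight f a 1 ltr01.
have [b yb] := proj_nonempty y A (ex_intro _ p Ap); have [Ab _] := yb.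
have gp := gate y p b Ap yb; have gq := gate y q b Aq yb.
have := metric_triangle a b y; rewrite (metric_sym b y).
have := hull_ge_mdist f y p; have := hull_ge_mdist f y q.
have := hypA a b p q Aa Ab Ap Aq; rewrite (metric_sym p b) -!lerBlDr !le_max.
by move=> /orP[] H *; apply/orP; [left|right]; lra.
Qed.

(** In [hull_coarsely_convex], walking from an almost minimiser [p] a distance
[5 * C + 15], two more than the error there, rules out the first term of the
maximum. *)
Lemma hull_growth f p q : A p -> A q -> (forall a, A a -> f p <= f a + 1) ->
  f p + mdist p q <= f q + (10 * C + 29).
Proof.
have C0 := hC.
move=> Ap Aq pmin.
have [short|long] := leP (mdist p q) (5 * C + 15).
  by have := pmin q Aq; lra.
have [|a Aa] := hull_coarsely_convex f p q (5 * C + 15) Ap Aq; first by lra.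
by rewrite -lerBlDr le_max; have := pmin a Aa => ? /orP[]; lra.
Qed.

(** Let [y] be tight for [q], with projection [b].  Up to constants,
[f q - f p] is at most [mdist q b - mdist p b] by tightness and at least
[mdist p q] by [hull_growth], so [p] lies coarsely between [b] and [q]. *)
Lemma hull_far_witness f p q : A p -> A q ->
  (forall a, A a -> f p <= f a + 1) ->
  exists y b, [/\ Defs.proj A y b, f q + f y <= mdist q y + 1 &
    mdist b p + mdist p q <= mdist b q + (12 * C + 36)].
Proof.
have C0 := hC.
move=> Ap Aq pmin; have [y qy] := hull_tight f q 1 ltr01.
have [b yb] := proj_nonempty y A (ex_intro _ p Ap).
exists y, b; split => //.
have := hull_growth f p q Ap Aq pmin; have := gate y p b Ap yb.
have := hull_ge_mdist f y p; have := metric_triangle y b q.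
by rewrite (metric_sym y q); lra.
Qed.

(** Only the lower bound on [f z - g z] is at stake: [f z] is bounded below by
[mdist y z - f y], with [y] tight for [f] at [q], and [g z] from above by
[mdist p z - g p + 1], with [z] tight for [g] at [p]. *)
Lemma hull_near_projections f g p q : A p -> A q ->
  (forall a, A a -> f p <= f a + 1) -> (forall a, A a -> g q <= g a + 1) ->
  mdist f g <= f p -> mdist p q <= 49 * C + 150.
Proof.
have C0 := hC.
move=> Ap Aq pmin qmin fg.
have [y [b [yb qy bpq]]] := hull_far_witness f p q Ap Aq pmin.
have [z [c [zc pz cqp]]] := hull_far_witness g q p Aq Ap qmin.
have fgrow := hull_growth f p q Ap Aq pmin.
have ggrow := hull_growth g q p Aq Ap qmin.
rewrite (metric_sym q p) in cqp ggrow.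
have bp0 := mdist_ge0 b p; have cq0 := mdist_ge0 c q.
have := hypA b q p c yb.1 Aq Ap zc.1.
rewrite (metric_sym p c) (metric_sym q c) -lerBlDr le_max.
(* The other pairing would give [2 * mdist p q] a constant bound. *)
move=> /orP[chain|crossed]; last by lra.
have [bc|bc] := leP (mdist b c) (2 * C + 8); first by lra.
have big := proj_two_gates hC geoX cA y z b c yb zc bc.
have fyz := hull_ge_mdist f y z.
have qby := metric_triangle q b y; have qpb := metric_triangle q p b.
have pcz := metric_triangle p c z; have pqc := metric_triangle p q c.
rewrite (metric_sym q b) (metric_sym b y) in qby.
rewrite (metric_sym q b) (metric_sym q p) (metric_sym p b) in qpb.
rewrite (metric_sym p c) in pcz.
rewrite (metric_sym p c) (metric_sym q c) in pqc.
(* [hull_growth] bounds [g p] below by [mdist p q] and [f q] by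
[f p + mdist p q], up to constants. *)
have g0 := hull_ge0 g q.
by have := le_trans (ler_norm _) (le_trans (hull_dist_ub f g z) fg); lra.
Qed.

End HullOverHyperbolic.

Theorem theorem5p6 (R : realType) (C : R) (hC : 0 <= C) :
  exists D : R, 0 <= D /\
    forall (X : metricType R) (A : set X),
      geodesic_space X ->
      strongly_contracting C A ->
      four_point C A ->
      strongly_contracting D (hull_embed @` A).
Proof.
exists (2 * (49 * C + 150)); split; first by lra.
move=> X A geoX cA hypA f r r0 disj; apply: diam_le => g1 g2.
move=> [h1 /= fh1 /proj_hull_embed[q1 <- [Aq1 min1]]].
move=> [h2 /= fh2 /proj_hull_embed[q2 <- [Aq2 min2]]].
rewrite hull_embed_isometry.
have [_ /proj_hull_embed[p _ [Ap pmin]]] := proj_nonempty f (hull_embed @` A)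
  (ex_intro _ _ (imageP hull_embed Aq1)).
have rp : r < f p.
  rewrite ltNge; apply/negP => fpr; suff : set0 (hull_embed p) by [].
  by rewrite -disj; split; [rewrite /mclosed_ball /= mdist_hull_embed|exists p].
have near h q (fh : mdist f h <= r) (Aq : A q)
    (qmin : forall a, A a -> h q <= h a + 1) : mdist p q <= 49 * C + 150.
  apply: (hull_near_projections hC geoX cA hypA f h) => //.
  exact: le_trans fh (ltW rp).
have := near h1 q1 fh1 Aq1 min1; have := near h2 q2 fh2 Aq2 min2.
by have := metric_triangle q1 p q2; rewrite (metric_sym q1 p); lra.
Qed.
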